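(* Let $E$ be a pseudo effect algebra with (RDP). Then every measure $m$ on $E$ can be uniquely expressed in the form $m=m_1+m_2$, where $m_1$ is an upwards continuous measure and $m_2$ is a (finitely additive) measure on $E$ such that if $t$ is an upwards continuous measure with $t\le^+m_2$, then $t=0$. In particular, every state $s$ on $E$ can be uniquely expressed as a convex combination $s=\lambda_1s_1+\lambda_2s_2$, where $s_1$ is an upwards continuous state and $s_2$ is a (finitely additive) state such that if $\alpha s'\le^+s_2$ for some upwards continuous state $s'$ on $E$ and some constant $\alpha\ge0$, then $\alpha=0$.
   Context: A pseudo effect algebra is a partial algebra $(E;+,0,1)$ with a partial binary operation $+$ and constants $0,1$ such that for all $a,b,c\in E$: (i) $a+b$ and $(a+b)+c$ exist iff $b+c$ and $a+(b+c)$ exist, and then $(a+b)+c=a+(b+c)$; (ii) there is exactly one $d$ and exactly one $e$ in $E$ with $a+d=e+a=1$; (iii) if $a+b$ exists, there are $d,e\in E$ with $a+b=d+a=b+e$; (iv) if $1+a$ or $a+1$ exists, then $a=0$. The partial order is $a\le b$ iff $a+c=b$ for some $c\in E$. $E$ has (RDP) if whenever $a_1+a_2=b_1+b_2$ (both sums defined), there are $d_1,d_2,d_3,d_4\in E$ with $d_1+d_2=a_1$, $d_3+d_4=a_2$, $d_1+d_3=b_1$, $d_2+d_4=b_2$. A measure on $E$ is a map $m:E\to[0,\infty)$ with $m(a+b)=m(a)+m(b)$ whenever $a+b$ is defined; a state is a measure with $s(1)=1$. $m_1\le^+m_2$ means $m_1(a)\le m_2(a)$ for all $a\in E$. For a nonempty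 family, $\{a_t\}\uparrow a$ means that $\{a_t\}$ is directed upwards (any two members have an upper bound in the family) and $a=\bigvee_ta_t$. A measure $m$ is upwards continuous if $\{a_t\}\uparrow a$ in $E$ implies $\{m(a_t)\}\uparrow m(a)$ in $\mathbb R$. Convex combination means $\lambda_1,\lambda_2\ge0$, $\lambda_1+\lambda_2=1$. Uniqueness of the convex combination means: the coefficients $\lambda_i$ are uniquely determined, and $s_i$ is uniquely determined whenever $\lambda_i>0$; a term with coefficient $0$ may be omitted (relevant when no state of the required kind exists). *)

(* Defs.v *)
From mathcomp Require Import all_boot all_order all_algebra.
From mathcomp Require Import boolp classical_sets reals.
Set Implicit Arguments.
Unset Strict Implicit.
Unset Printing Implicit Defensive.
Import Order.TTheory GRing.Theory Num.Theory.

Local Open Scope classical_set_scope.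
Local Open Scope ring_scope.

(* The partial operation is option-valued: [padd a b = Some c] means that
   a + b is defined and equal to c. Equality in [option] in [paddA] says both
   that the two sides are defined simultaneously and that they then agree. *)
Record pseudoEffectAlgebra := PseudoEffectAlgebra {
  pea_sort :> Type;
  padd : pea_sort -> pea_sort -> option pea_sort;
  pzero : pea_sort;
  pone : pea_sort;
  paddA : forall a b c,
    obind (fun ab => padd ab c) (padd a b) =
    obind (fun bc => padd a bc) (padd b c);
  pcompl : forall a,
    (exists! d, padd a d = Some pone) /\ (exists! e, padd e a = Some pone);
  pconj : forall a b c, padd a b = Some c ->
    exists d e, padd d a = Some c /\ padd b e = Some c;
  pone_max : forall a,
    (exists b, padd pone a = Some b) \/ (exists b, padd a pone = Some b) ->
    a = pzero
}.

Arguments padd {p} _ _.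
Arguments pzero {p}.
Arguments pone {p}.

Definition ple (E : pseudoEffectAlgebra) (a b : E) : Prop :=
  exists c : E, padd a c = Some b.

Definition RDP (E : pseudoEffectAlgebra) : Prop :=
  forall a1 a2 b1 b2 c : E,
    padd a1 a2 = Some c -> padd b1 b2 = Some c ->
    exists d1 d2 d3 d4 : E,
      [/\ padd d1 d2 = Some a1, padd d3 d4 = Some a2,
          padd d1 d3 = Some b1 & padd d2 d4 = Some b2].

(* A family is represented by the set of its members. *)
Definition increases_to (T : Type) (le : T -> T -> Prop) (A : set T) (a : T)
    : Prop :=
  [/\ A !=set0,
      (forall x y, A x -> A y -> exists z, [/\ A z, le x z & le y z]),
      (forall x, A x -> le x a)
    & (forall b, (forall x, A x -> le x b) -> le a b)].

Section Measures.
Variables (R : realType) (E : pseudoEffectAlgebra).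
Implicit Types m s t : E -> R.

Definition is_measure m : Prop :=
  (forall a, 0 <= m a) /\
  (forall a b c, padd a b = Some c -> m c = m a + m b).

Definition is_state s : Prop := is_measure s /\ s pone = 1.

Definition measure_le m1 m2 : Prop := forall a, m1 a <= m2 a.

Definition upwards_continuous m : Prop :=
  forall (A : set E) (a : E), increases_to (@ple E) A a ->
    increases_to (fun x y : R => x <= y) (m @` A) (m a).

Definition no_uc_measure_below m : Prop :=
  forall t, is_measure t -> upwards_continuous t -> measure_le t m ->
    t = (fun=> 0).

Definition no_uc_state_below s : Prop :=
  forall s' (alpha : R), is_state s' -> upwards_continuous s' -> 0 <= alpha ->
    measure_le (fun a => alpha * s' a) s -> alpha = 0.

Definition measure_decomposition m (p : (E -> R) * (E -> R)) : Prop :=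
  [/\ is_measure p.1 /\ upwards_continuous p.1,
      is_measure p.2 /\ no_uc_measure_below p.2
    & m = (fun a => p.1 a + p.2 a)].

(* A term with coefficient 0 counts as omitted: nothing is required of the
   corresponding function, whose contribution to the sum is 0. *)
Definition state_decomposition s (l1 l2 : R) s1 s2 : Prop :=
  [/\ [/\ 0 <= l1, 0 <= l2 & l1 + l2 = 1],
      0 < l1 -> is_state s1 /\ upwards_continuous s1,
      0 < l2 -> is_state s2 /\ no_uc_state_below s2
    & s = (fun a => l1 * s1 a + l2 * s2 a)].

End Measures.

(* Main.v *)
(** With (RDP), the function v a = sup {m a' - n a' : a' a right summand of a}
    is a measure, the positive part (m - n)^+ of m - n: it dominates m - n and
    lies below every measure that does. Upwards continuity is inherited by
    smaller measures, sums and directed suprema. The upwards continuous measures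
    below m are directed, since t + (u - t)^+ bounds t and u, so their supremum
    is the largest one and serves as m1. If m = m1 + m2 = n1 + n2 are two
    decompositions, then (m1 - n1)^+ is below both m1 and n2, so it is upwards
    continuous, hence 0; thus m1 <= n1, and equality holds by symmetry. *)
Require Import Defs.
From mathcomp Require Import all_boot all_order all_algebra.
From mathcomp Require Import boolp classical_sets reals.
From mathcomp Require Import ring lra.
Import Order.TTheory GRing.Theory Num.Theory.
Local Open Scope ring_scope.

(** * Neutral element and right summands in the partial algebra *)

Section Algebra.
Local Set Implicit Arguments.
Local Unset Strict Implicit.
Context {E : pseudoEffectAlgebra}.
Implicit Types a b c x y : E.

Lemma paddAl a b c x y : padd a b = Some x -> padd x c = Some y ->
  exists2 z, padd b c = Some z & padd a z = Some y.
Proof.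
move=> ab xc; have := paddA a b c.
rewrite ab /= xc; case: (padd b c) => //= z az.
by exists z.
Qed.

Lemma paddAr a b c x y : padd b c = Some x -> padd a x = Some y ->
  exists2 z, padd a b = Some z & padd z c = Some y.
Proof.
move=> bc ax; have := paddA a b c.
rewrite bc /= ax; case: (padd a b) => //= z zc.
by exists z.
Qed.

(** The right complement of 1 exists, and [pone_max] forces it to be 0. *)
Lemma padd10 : padd pone pzero = Some (pone : E).
Proof.
have [[d [d1 _]] _] := pcompl (pone : E).
by have d0 : d = pzero by [apply: pone_max; left; exists pone]; rewrite -d0.
Qed.

Lemma padd01 : padd pzero pone = Some (pone : E).
Proof.
have [_ [d [d1 _]]] := pcompl (pone : E).
by have d0 : d = pzero by [apply: pone_max; right; exists pone]; rewrite -d0.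
Qed.

(** If e + a = 1, then e + (a + 0) = 1 + 0 = 1 as well, and right complements of e are unique. *)
Lemma padda0 a : padd a pzero = Some a.
Proof.
have [_ [e [ea _]]] := pcompl a.
have [z az ez] := paddAl ea padd10.
have [[d [_ dU]] _] := pcompl e.
by rewrite az -(dU _ ez) (dU _ ea).
Qed.

Lemma padd0a a : padd pzero a = Some a.
Proof.
have [[e [ae _]] _] := pcompl a.
have [z za ze] := paddAr ae padd01.
have [_ [d [_ dU]]] := pcompl e.
by rewrite za -(dU _ ze) (dU _ ae).
Qed.

Lemma ple1 a : ple a pone.
Proof. by have [[d [ad _]] _] := pcompl a; exists d. Qed.

(* In b1 + c1 + b2 + c2 the conjugation axiom moves b2 past c1. *)
Lemma right_summandD a1 a2 a b1 c1 b2 c2 :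
    padd a1 a2 = Some a -> padd b1 c1 = Some a1 -> padd b2 c2 = Some a2 ->
  exists b c, padd c1 c2 = Some c /\ padd b c = Some a.
Proof.
move=> ha h1 h2.
have [x c1a2 b1x] := paddAl h1 ha.
have [y c1b2 yc2] := paddAr h2 c1a2.
have [d [_ [dc1 _]]] := pconj c1b2.
have [z c1c2 dz] := paddAl dc1 yc2.
have [w _ wz] := paddAr dz b1x.
by exists w, z.
Qed.

End Algebra.

(** * Measures and upwards continuity *)

Section MeasureTheory.
Local Set Implicit Arguments.
Local Unset Strict Implicit.
Context {R : realType} {E : pseudoEffectAlgebra}.
Implicit Types m n t u s : E -> R.

Lemma measureD m a b c : is_measure m -> padd a b = Some c -> m c = m a + m b.
Proof. by case=> _; apply. Qed.

Lemma measure_ge0 m a : is_measure m -> 0 <= m a.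
Proof. by case. Qed.

Lemma measure_zero m : is_measure m -> m pzero = 0.
Proof. by move=> mm; have := measureD mm (padda0 pzero); lra. Qed.

Lemma measure_mono m a b : is_measure m -> ple a b -> m a <= m b.
Proof.
by move=> mm [c ac]; rewrite (measureD mm ac) lerDl measure_ge0.
Qed.

Lemma measure_le1 m a : is_measure m -> m a <= m pone.
Proof. by move=> mm; apply: measure_mono (ple1 a). Qed.

Lemma measure_eq0 m : is_measure m -> m pone = 0 -> m = (fun=> 0).
Proof.
move=> mm m1; apply/funext => a; apply/eqP.
by rewrite eq_le measure_ge0 // -m1 measure_le1.
Qed.

Lemma is_measure0 : is_measure (fun _ : E => 0 : R).
Proof. by split=> // a b c _; rewrite addr0. Qed.

Lemma is_measureD m n : is_measure m -> is_measure n ->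
  is_measure (fun a => m a + n a).
Proof.
move=> mm mn; split=> [a|a b c abc]; first by rewrite addr_ge0 ?measure_ge0.
by rewrite (measureD mm abc) (measureD mn abc); ring.
Qed.

Lemma is_measureB m n : is_measure m -> is_measure n -> measure_le n m ->
  is_measure (fun a => m a - n a).
Proof.
move=> mm mn nm; split=> [a|a b c abc]; first by rewrite subr_ge0.
by rewrite (measureD mm abc) (measureD mn abc); ring.
Qed.

Lemma is_measureZ (k : R) m : 0 <= k -> is_measure m ->
  is_measure (fun a => k * m a).
Proof.
move=> k0 mm; split=> [a|a b c abc]; first by rewrite mulr_ge0 // measure_ge0.
by rewrite (measureD mm abc); ring.
Qed.

(** Monotonicity of [m] makes the image of [A] directed and bounded by [m a], so only leastness of
    that bound has content. *)
Lemma upwards_continuousP m : is_measure m ->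
  upwards_continuous m <->
  (forall A a b, increases_to (@ple E) A a -> (forall x, A x -> m x <= b) ->
    m a <= b).
Proof.
move=> mm; split=> [mc A a b Aa mAb|mc A a Aa].
  have [_ _ _ lub] := mc A a Aa.
  by apply: lub => _ [x Ax <-]; exact: mAb.
have [[x0 Ax0] dirA ubA _] := Aa; split.
- by exists (m x0), x0.
- move=> _ _ [x Ax <-] [y Ay <-]; have [z [Az xz yz]] := dirA x y Ax Ay.
  by exists (m z); split; [exists z | apply: measure_mono..].
- by move=> _ [x Ax <-]; apply: measure_mono => //; exact: ubA.
- by move=> b mAb; apply: (mc A) => // x Ax; apply: mAb; exists x.
Qed.

Lemma uc0 : upwards_continuous (fun _ : E => 0 : R).
Proof.
apply/(upwards_continuousP is_measure0).
by move=> A a b [[x Ax] _ _ _] /(_ x Ax).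
Qed.

Lemma ucD m n : is_measure m -> is_measure n ->
  upwards_continuous m -> upwards_continuous n ->
  upwards_continuous (fun a => m a + n a).
Proof.
move=> mm mn /(upwards_continuousP mm) mc /(upwards_continuousP mn) nc.
apply/(upwards_continuousP (is_measureD mm mn)).
move=> A a b Aa Ab; have [_ dirA _ _] := Aa.
(* The limits are taken one at a time: by directedness m x + n y <= m z + n z for some z in [A]
   above both x and y. *)
rewrite -lerBrDr; apply: (mc A) => // x Ax.
rewrite lerBrDr -lerBrDl; apply: (nc A) => // y Ay.
have [z [Az xz yz]] := dirA x y Ax Ay.
by have := Ab z Az; have := measure_mono mm xz; have := measure_mono mn yz; lra.
Qed.

Lemma ucZ (k : R) m : 0 <= k -> is_measure m -> upwards_continuous m ->
  upwards_continuous (fun a => k * m a).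
Proof.
rewrite le0r => /predU1P[->|k0] mm.
  by under eq_fun do rewrite mul0r; move=> _; exact: uc0.
move=> /(upwards_continuousP mm) mc.
apply/(upwards_continuousP (is_measureZ (ltW k0) mm)).
move=> A a b Aa Ab; rewrite -ler_pdivlMl //.
by apply: (mc A) => // x Ax; rewrite ler_pdivlMl //; exact: Ab.
Qed.

(** The difference m - t is monotone, so m x <= (m a - t a) + t x for x in [A]. A bound [b] of [t]
    on [A] thus gives a bound of [m] there, and continuity of [m] carries it to [a]. *)
Lemma uc_le m t : is_measure m -> is_measure t -> upwards_continuous m ->
  measure_le t m -> upwards_continuous t.
Proof.
move=> mm mt /(upwards_continuousP mm) mc tm; apply/(upwards_continuousP mt).
move=> A a b Aa Ab; have [_ _ ubA _] := Aa.
suff : m a <= m a - t a + b by lra.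
apply: (mc A) => // x Ax; have [y xy] := ubA x Ax.
have := Ab x Ax; have := tm y.
by rewrite (measureD mm xy) (measureD mt xy); lra.
Qed.

(** * The positive part of a difference of measures *)

Definition measure_pos_part m n a : R :=
  sup [set m c - n c | c in [set c | exists b, padd b c = Some a]]%classic.

Lemma le_measure_pos_part m n b c a : is_measure m -> is_measure n ->
  padd b c = Some a -> m c - n c <= measure_pos_part m n a.
Proof.
move=> mm mn bca; apply: ub_le_sup; last by exists c => //; exists b.
(* The set is bounded, since m c' - n c' <= m c' <= m a; otherwise [sup] would be a default
   value. *)
exists (m a) => _ [c' [b' bca'] <-].
by have := measureD mm bca'; have := measure_ge0 b' mm;
  have := measure_ge0 c' mn; lra.
Qed.

Lemma measure_pos_part_le m n a (M : R) :
  (forall b c, padd b c = Some a -> m c - n c <= M) ->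
  measure_pos_part m n a <= M.
Proof.
move=> le_M; apply: ge_sup.
  by exists (m a - n a), a => //; exists pzero; exact: padd0a.
by move=> _ [c [b bca] <-]; exact: le_M bca.
Qed.

Lemma measure_pos_part_ge m n a : is_measure m -> is_measure n ->
  m a - n a <= measure_pos_part m n a.
Proof. by move=> mm mn; apply: le_measure_pos_part (padd0a a). Qed.

Lemma measure_pos_part_min m n t : is_measure t ->
  (forall a, m a - n a <= t a) -> measure_le (measure_pos_part m n) t.
Proof.
move=> mt mnt a; apply: measure_pos_part_le => b c bca.
by have := mnt c; have := measureD mt bca; have := measure_ge0 b mt; lra.
Qed.

(** Subadditivity is where (RDP) enters: it splits a right summand of a1 + a2 into right summands of
    a1 and a2. Superadditivity is [right_summandD], which joins two such summands into one. *)
Lemma is_measure_pos_part m n : RDP E -> is_measure m -> is_measure n ->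
  is_measure (measure_pos_part m n).
Proof.
move=> rdp mm mn; split=> [a|a1 a2 a a12].
  have := le_measure_pos_part mm mn (padda0 a).
  by rewrite !measure_zero // subrr.
apply/eqP; rewrite eq_le; apply/andP; split.
  apply: measure_pos_part_le => b c bc.
  have [d1 [d2 [d3 [d4 [h1 h2 _ h4]]]]] := rdp _ _ _ _ _ a12 bc.
  rewrite (measureD mm h4) (measureD mn h4).
  have := le_measure_pos_part mm mn h1.
  by have := le_measure_pos_part mm mn h2; lra.
rewrite -lerBrDr; apply: measure_pos_part_le => b1 c1 h1.
rewrite lerBrDl -lerBrDr; apply: measure_pos_part_le => b2 c2 h2.
have [b [c [c12 bc]]] := right_summandD a12 h1 h2.
have := le_measure_pos_part mm mn bc.
by rewrite (measureD mm c12) (measureD mn c12); lra.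
Qed.

(** * The largest upwards continuous measure below [m] *)

Definition uc_below m t :=
  [/\ is_measure t, upwards_continuous t & measure_le t m].

Definition uc_part m a : R := sup [set t a | t in uc_below m]%classic.

Lemma uc_below0 m : is_measure m -> uc_below m (fun=> 0).
Proof.
by move=> mm; split; [exact: is_measure0 | exact: uc0 | case: mm].
Qed.

Lemma uc_below_directed m t u : RDP E -> is_measure m ->
  uc_below m t -> uc_below m u ->
  exists v, [/\ uc_below m v, measure_le t v & measure_le u v].
Proof.
move=> rdp mm [mt tc tm] [mu uc um].
have mp := is_measure_pos_part rdp mu mt.
exists (fun a => t a + measure_pos_part u t a); split.
- split; first exact: is_measureD.
    (* Continuity of (u - t)^+ comes from (u - t)^+ <= u. *)
    apply: ucD => //; apply: (uc_le mu mp uc).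
    by apply: measure_pos_part_min => // a; rewrite gerBl measure_ge0.
  (* The measure m - t dominates u - t, hence also (u - t)^+. *)
  move=> a; rewrite -lerBrDl.
  apply: (measure_pos_part_min (t := fun a => m a - t a)).
    exact: is_measureB.
  by move=> b; rewrite lerD2r.
- by move=> a; rewrite lerDl measure_ge0.
- by move=> a; rewrite -lerBlDl; apply: measure_pos_part_ge.
Qed.

Lemma le_uc_part m t : uc_below m t -> measure_le t (uc_part m).
Proof.
move=> mt a; apply: ub_le_sup; last by exists t.
by exists (m a) => _ [u [_ _ um] <-]; exact: um.
Qed.

Lemma uc_part_le m a (M : R) : is_measure m ->
  (forall t, uc_below m t -> t a <= M) -> uc_part m a <= M.
Proof.
move=> mm le_M; apply: ge_sup => [|_ [t mt <-]]; last exact: le_M.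
by exists 0, (fun=> 0) => //; exact: uc_below0.
Qed.

Lemma uc_below_uc_part m : RDP E -> is_measure m -> uc_below m (uc_part m).
Proof.
move=> rdp mm.
have mp : is_measure (uc_part m).
  split=> [a|a b c abc]; first exact: le_uc_part (uc_below0 mm) a.
  apply/eqP; rewrite eq_le; apply/andP; split.
    apply: uc_part_le => // t mt; have [tm _ _] := mt.
    by rewrite (measureD tm abc) lerD ?le_uc_part.
  (* Superadditivity needs directedness: t a + u b <= v a + v b = v c for a common bound v of t and
     u. *)
  rewrite -lerBrDr; apply: uc_part_le => // t mt.
  rewrite lerBrDl -lerBrDr; apply: uc_part_le => // u mu.
  have [v [mv tv uv]] := uc_below_directed rdp mm mt mu.
  have [vm _ _] := mv; have := le_uc_part mv c; rewrite (measureD vm abc).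
  by have := tv a; have := uv b; lra.
split=> //; last by move=> a; apply: uc_part_le => // t [_ _]; apply.
(* A bound of the supremum on [A] bounds each competitor t there, so t a <= b by continuity of t. *)
apply/(upwards_continuousP mp) => A a b Aa Ab.
apply: uc_part_le => // t mt; have [tm tc _] := mt.
apply: (proj1 (upwards_continuousP tm) tc A) => // x Ax.
exact: le_trans (le_uc_part mt x) (Ab x Ax).
Qed.

Lemma uc_part_decomposition m : RDP E -> is_measure m ->
  measure_decomposition m (uc_part m, fun a => m a - uc_part m a).
Proof.
move=> rdp mm; have [mp pc pm] := uc_below_uc_part rdp mm.
split=> //=; last by apply/funext => a; rewrite addrC subrK.
split=> [|t mt tc tle]; first exact: is_measureB.
apply: measure_eq0 => //; apply/eqP; rewrite eq_le measure_ge0 // andbT.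
(* Adding t to the largest competitor gives another competitor, so t cannot be positive at 1. *)
suff /le_uc_part/(_ pone) : uc_below m (fun a => uc_part m a + t a).
  by rewrite gerDl.
split; [exact: is_measureD | exact: ucD |].
by move=> a; rewrite -lerBrDl; exact: tle.
Qed.

(** * Uniqueness of the decomposition of a measure *)

Lemma measure_decomposition_le m p q : RDP E ->
  measure_decomposition m p -> measure_decomposition m q ->
  measure_le p.1 q.1.
Proof.
move=> rdp [[mp1 pc] [mp2 _] mpE] [[mq1 _] [mq2 nq] mqE] a.
have mpq := is_measure_pos_part rdp mp1 mq1.
have v0 : measure_pos_part p.1 q.1 = (fun=> 0).
  apply: nq => //.
    apply: (uc_le mp1 mpq pc); apply: measure_pos_part_min => // b.
    by rewrite gerBl measure_ge0.
  (* The two expressions of [m] give p.1 - q.1 = q.2 - p.2 <= q.2. *)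
  apply: measure_pos_part_min => // b.
  have := congr1 (@^~ b) mpE; rewrite {1}mqE /= => pqE.
  by have := measure_ge0 b mp2; lra.
have := measure_pos_part_ge a mp1 mq1.
by rewrite v0 subr_le0.
Qed.

Lemma measure_decomposition_inj m p q : RDP E ->
  measure_decomposition m p -> measure_decomposition m q -> p = q.
Proof.
move=> rdp mp mq.
have pq1 : p.1 = q.1.
  apply/funext => a; apply/eqP; rewrite eq_le.
  by rewrite (measure_decomposition_le rdp mp mq)
             (measure_decomposition_le rdp mq mp).
rewrite (surjective_pairing p) (surjective_pairing q) pq1; congr pair.
case: mp => _ _ mpE; case: mq => _ _ mqE; apply/funext => a.
have := congr1 (@^~ a) mpE; rewrite {1}mqE /= pq1.
by move/addrI.
Qed.

(** * Passage between measures and states by normalization *)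

Lemma is_state_normalize m : is_measure m -> 0 < m pone ->
  is_state (fun a => (m pone)^-1 * m a).
Proof.
move=> mm m1; split; last by rewrite mulVf ?gt_eqF.
by apply: is_measureZ; rewrite // invr_ge0 ltW.
Qed.

(** The case m 1 = 0 is harmless because [m] then vanishes identically. *)
Lemma measureK m a : is_measure m -> m pone * ((m pone)^-1 * m a) = m a.
Proof.
move=> mm; have [m1|m1] := eqVneq (m pone) 0; last by rewrite mulrA divff ?mul1r.
by rewrite (measure_eq0 mm m1) !mulr0.
Qed.

Lemma no_uc_state_below_normalize m : 0 < m pone -> no_uc_measure_below m ->
  no_uc_state_below (fun a => (m pone)^-1 * m a).
Proof.
move=> m1 nm s' alpha [ms' s'1] s'c alpha0 s'm.
have k0 : 0 <= m pone * alpha by rewrite mulr_ge0 // ltW.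
have /nm : is_measure (fun a => m pone * alpha * s' a) by exact: is_measureZ.
move=> /(_ (ucZ k0 ms' s'c)) h.
have /h/(congr1 (@^~ pone)) /= : measure_le (fun a => m pone * alpha * s' a) m.
  by move=> a; rewrite -mulrA -ler_pdivlMl //; exact: s'm.
by rewrite s'1 mulr1 => /eqP; rewrite mulf_eq0 gt_eqF //= => /eqP.
Qed.

Lemma no_uc_measure_below_scale (l : R) s : 0 < l -> no_uc_state_below s ->
  no_uc_measure_below (fun a => l * s a).
Proof.
move=> l0 ns t mt tc tle; apply: measure_eq0 => //; apply/eqP.
apply: contraT => tn0.
have t1 : 0 < t pone by rewrite lt_def tn0 measure_ge0.
have t1V : 0 <= (t pone)^-1 by rewrite invr_ge0 ltW.
(* A nonzero t would normalize to an upwards continuous state, whose multiple by t 1 / l lies below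
   [s]. *)
have : l^-1 * t pone = 0.
  apply: (ns _ _ (is_state_normalize mt t1) (ucZ t1V mt tc)).
    by rewrite mulr_ge0 ?invr_ge0 ?ltW.
  by move=> a; rewrite -mulrA measureK // ler_pdivrMl //; exact: tle.
by move/eqP; rewrite mulf_eq0 invr_eq0 (gt_eqF l0) (gt_eqF t1).
Qed.

(** This reduces uniqueness for states to uniqueness for measures. A zero coefficient turns an
    arbitrary function into the zero measure, which meets both requirements. *)
Lemma measure_decomposition_of_state s l1 l2 s1 s2 :
  state_decomposition s l1 l2 s1 s2 ->
  measure_decomposition s (fun a => l1 * s1 a, fun a => l2 * s2 a).
Proof.
move=> [[l1_ge0 l2_ge0 _] hs1 hs2 sE]; split=> //=.
- move: l1_ge0; rewrite le0r => /predU1P[->|l1_gt0].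
    by under eq_fun do rewrite mul0r; split; [exact: is_measure0 | exact: uc0].
  have [[ms1 _] s1c] := hs1 l1_gt0.
  by split; [apply: is_measureZ | apply: ucZ] => //; exact: ltW.
- move: l2_ge0; rewrite le0r => /predU1P[->|l2_gt0].
    under eq_fun do rewrite mul0r; split; first exact: is_measure0.
    move=> t mt _ t0; apply: measure_eq0 => //; apply/eqP.
    by rewrite eq_le measure_ge0 // andbT; exact: t0.
  have [[ms2 _] ns2] := hs2 l2_gt0.
  by split; [apply: is_measureZ => //; exact: ltW |
             exact: no_uc_measure_below_scale].
Qed.

(** Evaluation at 1 recovers the coefficient of a convex combination from its scaled term, even when
    the term counts as omitted. *)
Lemma scaled_state_one (l : R) s : 0 <= l -> (0 < l -> is_state s) ->
  l * s pone = l.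
Proof.
rewrite le0r => /predU1P[->|l0]; first by rewrite mul0r.
by case/(_ l0) => _ ->; rewrite mulr1.
Qed.

Lemma state_decomposition_inj s l1 l2 s1 s2 l1' l2' s1' s2' : RDP E ->
  state_decomposition s l1 l2 s1 s2 -> state_decomposition s l1' l2' s1' s2' ->
  [/\ l1 = l1', l2 = l2', (0 < l1 -> s1 = s1') & (0 < l2 -> s2 = s2')].
Proof.
move=> rdp ds ds'.
have [e1 e2] := measure_decomposition_inj rdp
  (measure_decomposition_of_state ds) (measure_decomposition_of_state ds').
have {ds} [[l1_ge0 l2_ge0 _] h1 h2 _] := ds.
have {ds'} [[l1'_ge0 l2'_ge0 _] h1' h2' _] := ds'.
have l1E : l1 = l1'.
  rewrite -(scaled_state_one l1_ge0 (fun l => proj1 (h1 l))).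
  rewrite -[RHS](scaled_state_one l1'_ge0 (fun l => proj1 (h1' l))).
  exact: (congr1 (@^~ pone) e1).
have l2E : l2 = l2'.
  rewrite -(scaled_state_one l2_ge0 (fun l => proj1 (h2 l))).
  rewrite -[RHS](scaled_state_one l2'_ge0 (fun l => proj1 (h2' l))).
  exact: (congr1 (@^~ pone) e2).
split=> // l_gt0; apply/funext => a.
- have /= := congr1 (@^~ a) e1; rewrite -l1E.
  by apply: mulfI; rewrite gt_eqF.
- have /= := congr1 (@^~ a) e2; rewrite -l2E.
  by apply: mulfI; rewrite gt_eqF.
Qed.

(* If a part vanishes, its normalization is the junk value 0, with
   coefficient 0. *)
Lemma state_decomposition_exists s : RDP E -> is_state s ->
  exists l1 l2 s1 s2, state_decomposition s l1 l2 s1 s2.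
Proof.
move=> rdp [ms s_one].
have := uc_part_decomposition rdp ms.
set m1 := uc_part s; set m2 := (fun a => s a - m1 a).
move=> [/= [mm1 m1c] [mm2 nm2] sE].
exists (m1 pone), (m2 pone), (fun a => (m1 pone)^-1 * m1 a),
  (fun a => (m2 pone)^-1 * m2 a); split.
- split; [exact: measure_ge0 | exact: measure_ge0 |].
  by rewrite -s_one [in RHS]sE.
- move=> m1_gt0; split; first exact: is_state_normalize.
  by apply: ucZ; rewrite // invr_ge0 ltW.
- move=> m2_gt0; split; first exact: is_state_normalize.
  exact: no_uc_state_below_normalize.
- by rewrite [LHS]sE; apply/funext => a; rewrite !measureK.
Qed.

End MeasureTheory.

Theorem theorem4p7 (R : realType) (E : pseudoEffectAlgebra) (hE : RDP E) :
  (forall m : E -> R, is_measure m ->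
     exists! p : (E -> R) * (E -> R), measure_decomposition m p)
  /\
  (forall s : E -> R, is_state s ->
     (exists (l1 l2 : R) (s1 s2 : E -> R), state_decomposition s l1 l2 s1 s2)
     /\
     (forall (l1 l2 l1' l2' : R) (s1 s2 s1' s2' : E -> R),
        state_decomposition s l1 l2 s1 s2 ->
        state_decomposition s l1' l2' s1' s2' ->
        [/\ l1 = l1', l2 = l2', (0 < l1 -> s1 = s1') & (0 < l2 -> s2 = s2')])).
Proof.
split=> [m mm|s ms].
  exists (uc_part m, fun a => m a - uc_part m a).
  split; first exact: uc_part_decomposition.
  by move=> p; apply: measure_decomposition_inj (uc_part_decomposition hE mm).
split; first exact: state_decomposition_exists.
by move=> *; apply: state_decomposition_inj; eassumption.
Qed.
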